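(* Let $N\ge 1$, $n_1,\dots,n_N\ge 1$, $m_1,\dots,m_N\ge 1$ and $1\le n\le \min_i n_i$ be integers. For $i=1,\dots,N$ let $\Omega_i\subset\mathbb{R}^{n_i}$ be a closed convex set, let $f_i:\mathbb{R}^{n_i}\to\mathbb{R}$ be convex and continuous, and let $g_i:\mathbb{R}^{n_i}\to\mathbb{R}^{m_i}$ be (componentwise) convex and continuous. Put $\Omega=\Omega_1\times\cdots\times\Omega_N$ and assume there is $\bar{\mathbf{x}}=\mathrm{col}[\bar x_1,\dots,\bar x_N]\in \mathrm{int}(\Omega)$ with $g_i(\bar x_i)<0$ (componentwise) for all $i$. If $(\hat{\mathbf{x}},\hat\lambda,\hat\mu)$ is an equilibrium point of the differential inclusion $$\begin{aligned}\dot{\mathbf{x}}&\in 2\delta P_{\Omega}\big(\mathbf{x}-\partial F(\mathbf{x})-\partial G(\mathbf{x})P_+^{\mu}-K_n\lambda-K_n\mathbf{x}\big)-2\delta\mathbf{x},\\ \dot\lambda&=K_n\mathbf{x},\\ \dot\mu&=\delta\,(P_+^{\mu}-\mu),\end{aligned}$$ where $\delta=\delta_{\max}(K_n)+1$, then $\hat{\mathbf{x}}$ is a solution (global minimizer) of the problem $$\min\ F(\mathbf{x})=\sum_{i=1}^N f_i(x_i)\quad\text{s.t.}\quad x_i^{(v_n)}=x_j^{(v_n)},\quad g_i(x_i)\le 0,\quad x_i\in\Omega_i,\qquad i,j=1,\dots,N.$$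
   Context: Notation. $\mathrm{col}[x_1,\dots,x_N]$ is the stacked column vector $[x_1^T,\dots,x_N^T]^T$. $\mathbf{x}=\mathrm{col}[x_1,\dots,x_N]$ with $x_i\in\mathbb{R}^{n_i}$; $\bar N=\sum_{i=1}^N n_i$. $\lambda=\mathrm{col}[\lambda_1,\dots,\lambda_N]$ with $\lambda_i\in\mathbb{R}^{n_i}$; $\mu=\mathrm{col}[\mu_1,\dots,\mu_N]$ with $\mu_i\in\mathbb{R}^{m_i}$. $v_n=\{1,\dots,n\}$, and $x_i^{(v_n)}\in\mathbb{R}^n$ is the vector of the first $n$ components of $x_i$. Partial-consensus matrix. $L_N$ is the $N\times N$ Laplacian matrix of an undirected connected graph on $N$ vertices (symmetric nonnegative edge weights). $K_n\in\mathbb{R}^{\bar N\times\bar N}$ is obtained from $L_N\otimes I_n$ by inserting zero rows and zero columns at the index positions in $\{1,\dots,\bar N\}$ that are not of the form $\sum_{t<a}n_t+r$ with $1\le a\le N$, $1\le r\le n$. Explicitly, for $p=\sum_{t<a}n_t+r$ and $q=\sum_{t<b}n_t+s$ with $1\le r\le n_a$, $1\le s\le n_b$, the $(p,q)$ entry of $K_n$ is $(L_N)_{ab}$ if $r=s\le n$, and $0$ otherwise. $\delta_{\max}(K_n)$ is the largest eigenvalue of $K_n$. Operators. $P_C$ is the Euclidean projection onto a closed convex set $C$. $P_+^{\mu}=\mathrm{col}[P_+^{\mu_1},\dots,P_+^{\mu_N}]$ with $P_+^{\mu_i}=P_{\mathbb{R}_+^{m_i}}(\mu_i+g_i(x_i))$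 (it depends on $\mathbf{x}$ as well; at an equilibrium it is evaluated at $\hat{\mathbf{x}},\hat\mu$). $G(\mathbf{x})=\mathrm{col}[g_1(x_1),\dots,g_N(x_N)]$. $\partial F$ is the generalized gradient (here the convex subdifferential). For $\nu=\mathrm{col}[\nu_1,\dots,\nu_N]$ with $\nu_i\in\mathbb{R}^{m_i}$, $\partial G(\mathbf{x})\nu$ is the set of vectors $\mathrm{col}[w_1,\dots,w_N]$ with $w_i=\sum_{k=1}^{m_i}\nu_{ik}\xi_{ik}$, $\xi_{ik}\in\partial g_{ik}(x_i)$, where $g_{ik}$ is the $k$-th component of $g_i$. The right-hand side of the first relation is the set obtained as one ranges over all elements of $\partial F(\mathbf{x})$ and $\partial G(\mathbf{x})P_+^{\mu}$. An equilibrium point is a point at which $0$ belongs to the right-hand side of each of the three relations. *)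

(* Defs.v *)
From HB Require Import structures.
From mathcomp Require Import all_boot all_order all_algebra.
From mathcomp Require Import all_classical all_reals all_analysis.

Set Implicit Arguments.
Unset Strict Implicit.
Unset Printing Implicit Defensive.

Import Order.TTheory GRing.Theory Num.Theory.
Import numFieldNormedType.Exports.

Local Open Scope classical_set_scope.
Local Open Scope ring_scope.

(* A stacked vector col[x_1, ..., x_N] is an element x of
   'cV[R]_(\sum_i n_ i); its i-th block x_i is submxcol x i.
   The norm the library puts on matrices is the sup norm: it induces the usual
   topology, but projections need the Euclidean norm defined here. *)

Definition dot (R : realType) (p : nat) (u v : 'cV[R]_p) : R :=
  (u^T *m v) 0 0.

Definition enorm (R : realType) (p : nat) (u : 'cV[R]_p) : R :=
  Num.sqrt (dot u u).

(* The default value 0 is only taken when u has no nearest point in C, which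
   cannot happen when C is closed, convex and nonempty. *)
Definition proj (R : realType) (p : nat) (C : set 'cV[R]_p) (u : 'cV[R]_p) :
    'cV[R]_p :=
  xget 0 [set z | C z /\ forall y, C y -> enorm (u - z) <= enorm (u - y)].

Definition orthant (R : realType) (p : nat) : set 'cV[R]_p :=
  [set z | forall k, 0 <= z k 0].

Definition subdiff (R : realType) (p : nat) (h : 'cV[R]_p -> R)
    (x : 'cV[R]_p) : set 'cV[R]_p :=
  [set v | forall y, h x + dot v (y - x) <= h y].

Definition blockprod (R : realType) (N : nat) (n_ : 'I_N -> nat)
    (Omega : forall i, set 'cV[R]_(n_ i)) : set 'cV[R]_(\sum_i n_ i) :=
  [set x | forall i, Omega i (submxcol x i)].

(* Weight matrices of undirected connected graphs; {a, b} is an edge when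
   W a b > 0. Diagonal weights are left free: they cancel in the Laplacian and
   do not affect connectedness. *)
Definition connected_weights (R : realType) (N : nat) (W : 'M[R]_N) : Prop :=
  [/\ forall a b, W a b = W b a,
      forall a b, 0 <= W a b
    & forall a b, connect (fun c d => 0 < W c d) a b].

Definition laplacian (R : realType) (N : nat) (W : 'M[R]_N) : 'M[R]_N :=
  diag_mx (\row_a \sum_b W a b) - W.

(* Indices are 0-based, so r < n says that r is one of the first n
   components. *)
Definition pc_matrix (R : realType) (N : nat) (n_ : 'I_N -> nat) (n : nat)
    (L : 'M[R]_N) : 'M[R]_(\sum_i n_ i) :=
  \mxblock_(a < N, b < N) \matrix_(r < n_ a, s < n_ b)
    if (r == s :> nat) && (r < n)%N then L a b else 0.

(* The default value 0 is not taken for real symmetric matrices of positive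
   size, which always have a largest eigenvalue. *)
Definition largest_eigenvalue (R : realType) (p : nat) (A : 'M[R]_p) : R :=
  xget 0 [set d | eigenvalue A d /\ forall a, eigenvalue A a -> a <= d].

Definition objective (R : realType) (N : nat) (n_ : 'I_N -> nat)
    (f : forall i, 'cV[R]_(n_ i) -> R) (x : 'cV[R]_(\sum_i n_ i)) : R :=
  \sum_i f i (submxcol x i).

Definition Pplus (R : realType) (N : nat) (n_ m_ : 'I_N -> nat)
    (g : forall i, 'cV[R]_(n_ i) -> 'cV[R]_(m_ i))
    (x : 'cV[R]_(\sum_i n_ i)) (mu : 'cV[R]_(\sum_i m_ i)) :
    'cV[R]_(\sum_i m_ i) :=
  \mxcol_i proj (@orthant R (m_ i))
    (submxcol mu i + g i (submxcol x i)).

Definition subdiffG (R : realType) (N : nat) (n_ m_ : 'I_N -> nat)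
    (g : forall i, 'cV[R]_(n_ i) -> 'cV[R]_(m_ i))
    (x : 'cV[R]_(\sum_i n_ i)) (nu : 'cV[R]_(\sum_i m_ i)) :
    set 'cV[R]_(\sum_i n_ i) :=
  [set w | exists xi : forall i, 'I_(m_ i) -> 'cV[R]_(n_ i),
     (forall i k, subdiff (fun z => g i z k 0) (submxcol x i) (xi i k)) /\
     w = \mxcol_i \sum_k submxcol nu i k 0 *: xi i k].

Definition rhs_x (R : realType) (N : nat) (n_ m_ : 'I_N -> nat)
    (Omega : forall i, set 'cV[R]_(n_ i))
    (f : forall i, 'cV[R]_(n_ i) -> R)
    (g : forall i, 'cV[R]_(n_ i) -> 'cV[R]_(m_ i))
    (K : 'M[R]_(\sum_i n_ i)) (delta : R)
    (x lambda : 'cV[R]_(\sum_i n_ i)) (mu : 'cV[R]_(\sum_i m_ i)) :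
    set 'cV[R]_(\sum_i n_ i) :=
  [set (2 * delta) *:
         proj (blockprod Omega) (x - v - w - K *m lambda - K *m x)
       - (2 * delta) *: x
   | v in subdiff (objective f) x & w in subdiffG g x (Pplus g x mu)].

Definition rhs_lambda (R : realType) (N : nat) (n_ : 'I_N -> nat)
    (K : 'M[R]_(\sum_i n_ i)) (x : 'cV[R]_(\sum_i n_ i)) :
    'cV[R]_(\sum_i n_ i) :=
  K *m x.

Definition rhs_mu (R : realType) (N : nat) (n_ m_ : 'I_N -> nat)
    (g : forall i, 'cV[R]_(n_ i) -> 'cV[R]_(m_ i)) (delta : R)
    (x : 'cV[R]_(\sum_i n_ i)) (mu : 'cV[R]_(\sum_i m_ i)) :
    'cV[R]_(\sum_i m_ i) :=
  delta *: (Pplus g x mu - mu).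

Definition equilibrium (R : realType) (N : nat) (n_ m_ : 'I_N -> nat)
    (Omega : forall i, set 'cV[R]_(n_ i))
    (f : forall i, 'cV[R]_(n_ i) -> R)
    (g : forall i, 'cV[R]_(n_ i) -> 'cV[R]_(m_ i))
    (K : 'M[R]_(\sum_i n_ i)) (delta : R)
    (x lambda : 'cV[R]_(\sum_i n_ i)) (mu : 'cV[R]_(\sum_i m_ i)) : Prop :=
  [/\ rhs_x Omega f g K delta x lambda mu 0,
      rhs_lambda K x = 0
    & rhs_mu g delta x mu = 0].

Definition firstn_mx (R : realType) (n p : nat) (hn : (n <= p)%N)
    (x : 'cV[R]_p) : 'cV[R]_n :=
  rowsub (widen_ord hn) x.

Definition feasible (R : realType) (N : nat) (n_ m_ : 'I_N -> nat) (n : nat)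
    (hn : forall i, (n <= n_ i)%N)
    (Omega : forall i, set 'cV[R]_(n_ i))
    (g : forall i, 'cV[R]_(n_ i) -> 'cV[R]_(m_ i)) :
    set 'cV[R]_(\sum_i n_ i) :=
  [set x | [/\ forall i j, firstn_mx (hn i) (submxcol x i) =
                           firstn_mx (hn j) (submxcol x j),
               forall i k, g i (submxcol x i) k 0 <= 0
             & forall i, Omega i (submxcol x i)]].

Definition global_minimizer (T : Type) (R : realType) (F : T -> R)
    (S : set T) (x : T) : Prop :=
  S x /\ forall y, S y -> F x <= F y.

(* Main.v *)
(* At an equilibrium, K x = 0 forces consensus because
   2 x^T K x = sum_(a, b) W_ab |x_a - x_b|^2 over the first n components, and
   mu = P_+(mu + g(x)) is the complementarity system mu >= 0, g(x) <= 0,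
   mu . g(x) = 0.  As delta > 0, the first relation says that x is its own
   projection x = P_Omega(x - v - w - K lambda), i.e. for y in Omega
     v . (y - x) >= - w . (y - x) - (K lambda) . (y - x).
   For feasible y the last term vanishes (y - x is a consensus vector) and
   w . (y - x) <= mu . (g(y) - g(x)) <= 0, so F(y) >= F(x).  Slater's point
   makes Omega nonempty, so that the projection exists. *)
Require Import Defs.
From HB Require Import structures.
From mathcomp Require Import all_boot all_order all_algebra.
From mathcomp Require Import all_classical all_reals all_analysis.
From mathcomp Require Import ring lra.
Set Implicit Arguments.
Unset Strict Implicit.
Import Order.TTheory GRing.Theory Num.Theory.
Import numFieldNormedType.Exports.
Local Open Scope classical_set_scope.
Local Open Scope ring_scope.

(** * Algebra of the Euclidean inner product *)

Lemma dotE (R : realType) (p : nat) (u v : 'cV[R]_p) :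
  dot u v = \sum_i u i 0 * v i 0.
Proof. by rewrite /dot mxE; apply: eq_bigr => i _; rewrite mxE. Qed.

Lemma dotC (R : realType) (p : nat) (u v : 'cV[R]_p) : dot u v = dot v u.
Proof. by rewrite !dotE; apply: eq_bigr => i _; rewrite mulrC. Qed.

Lemma dotDl (R : realType) (p : nat) (u v w : 'cV[R]_p) :
  dot (u + v) w = dot u w + dot v w.
Proof. by rewrite /dot linearD mulmxDl mxE. Qed.

Lemma dotDr (R : realType) (p : nat) (u v w : 'cV[R]_p) :
  dot u (v + w) = dot u v + dot u w.
Proof. by rewrite /dot mulmxDr mxE. Qed.

Lemma dotNl (R : realType) (p : nat) (u v : 'cV[R]_p) : dot (- u) v = - dot u v.
Proof. by rewrite /dot linearN mulNmx mxE. Qed.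

Lemma dotNr (R : realType) (p : nat) (u v : 'cV[R]_p) : dot u (- v) = - dot u v.
Proof. by rewrite /dot mulmxN mxE. Qed.

Lemma dotZl (R : realType) (p : nat) (a : R) (u v : 'cV[R]_p) :
  dot (a *: u) v = a * dot u v.
Proof. by rewrite /dot linearZ -scalemxAl mxE. Qed.

Lemma dotZr (R : realType) (p : nat) (a : R) (u v : 'cV[R]_p) :
  dot u (a *: v) = a * dot u v.
Proof. by rewrite /dot -scalemxAr mxE. Qed.

Lemma dot_suml (R : realType) (p : nat) (I : finType) (u : I -> 'cV[R]_p)
  (v : 'cV[R]_p) : dot (\sum_i u i) v = \sum_i dot (u i) v.
Proof. by rewrite /dot raddf_sum mulmx_suml summxE. Qed.

Lemma dot_sumr (R : realType) (p : nat) (I : finType) (u : 'cV[R]_p)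
  (v : I -> 'cV[R]_p) : dot u (\sum_i v i) = \sum_i dot u (v i).
Proof. by rewrite /dot mulmx_sumr summxE. Qed.

(** The increment is factored by [t], so that for [0 < t] the bracket alone decides whether the
    squared norm drops. *)
Lemma dot_subZ (R : realType) (p : nat) (t : R) (u v : 'cV[R]_p) :
  dot (u - t *: v) (u - t *: v) = dot u u - t * (2 * dot u v - t * dot v v).
Proof. rewrite dotDl !dotDr !dotNl !dotNr !dotZl !dotZr (dotC v u); ring. Qed.

Lemma dot_ge0 (R : realType) (p : nat) (u : 'cV[R]_p) : 0 <= dot u u.
Proof. by rewrite dotE; apply: sumr_ge0 => i _; rewrite -expr2 sqr_ge0. Qed.

Lemma dot_eq0 (R : realType) (p : nat) (u : 'cV[R]_p) : dot u u = 0 -> u = 0.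
Proof.
rewrite dotE => /eqP; rewrite psumr_eq0 => [/allP u0|i _]; last first.
  by rewrite -expr2 sqr_ge0.
apply/colP => i; rewrite mxE; apply/eqP.
by have := u0 i (mem_index_enum i); rewrite mulf_eq0 orbb.
Qed.

Lemma dot_blocks (R : realType) (N : nat) (n_ : 'I_N -> nat)
  (u v : 'cV[R]_(\sum_i n_ i)) :
  dot u v = \sum_i dot (submxcol u i) (submxcol v i).
Proof.
rewrite -{1}(submxcolK u) -{1}(submxcolK v) /dot tr_mxcol mul_mxrow_mxcol.
by rewrite summxE.
Qed.

(** * Existence of a nearest point in a nonempty closed set *)

Lemma mx_continuous (R : realType) (T : topologicalType) (m n : nat)
    (h : T -> 'M[R]_(m, n)) :
  (forall i j, continuous (fun t => h t i j)) -> continuous h.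
Proof.
(* A neighbourhood of a matrix contains a product of neighbourhoods of its finitely many entries. *)
move=> ch t A [P Pt PA]; suff: \forall s \near t, forall i j, P i j (h s i j).
  by apply: filterS => s; exact: PA.
by do 2![apply: filter_forall => ?]; exact/ch/Pt.
Qed.

Lemma enorm_sub_continuous (R : realType) (p : nat) (u : 'cV[R]_p) :
  continuous (fun y : 'cV[R]_p => enorm (u - y)).
Proof.
have -> : (fun y => enorm (u - y)) =
    Num.sqrt \o (fun y : 'cV[R]_p => \sum_i (u i 0 - y i 0) * (u i 0 - y i 0)).
  apply/funext => y; rewrite /enorm dotE /=; congr Num.sqrt.
  by apply: eq_bigr => i _; rewrite !mxE.
move=> y; apply: continuous_comp; last exact: sqrt_continuous.
apply: continuous_big => [|i _ {}y]; first exact: add_continuous.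
have ch : {for y, continuous (fun y : 'cV[R]_p => u i 0 - y i 0)}.
  by apply: continuousB; [exact: cst_continuous|exact: coord_continuous].
exact: (continuousM ch ch).
Qed.

(** Puts Euclidean balls inside the boxes of [box_compact]. *)
Lemma coord_le_enorm (R : realType) (p : nat) (u : 'cV[R]_p) i :
  `|u i 0| <= enorm u.
Proof.
rewrite -sqrtr_sqr ler_sqrt ?dot_ge0// dotE (bigD1 i)//= expr2 lerDl.
by apply: sumr_ge0 => j _; rewrite -expr2 sqr_ge0.
Qed.

(** Compactness of a product of segments is known for row vectors and is carried over by the
    continuous map [trmx]. *)
Lemma box_compact (R : realType) (p : nat) (u : 'cV[R]_p) (r : R) :
  compact [set y : 'cV[R]_p | forall i, `|u i 0 - y i 0| <= r].
Proof.
pose B := [set y : 'rV[R]_p | forall i, `[u i 0 - r, u i 0 + r]%classic (y 0 i)].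
have <- : trmx @` B = [set y : 'cV[R]_p | forall i, `|u i 0 - y i 0| <= r].
  apply/seteqP; split => [_ [y By <-] i|y By].
    have /= := By i; rewrite mxE in_itv /= ler_norml => /andP[? ?].
    by apply/andP; split; lra.
  exists y^T; last exact: trmxK.
  move=> i; have := By i; rewrite /= mxE in_itv /= ler_norml => /andP[? ?].
  by apply/andP; split; lra.
apply: continuous_compact; last first.
  apply: (@rV_compact R p (fun i => `[u i 0 - r, u i 0 + r]%classic)) => i.
  exact: segment_compact.
apply: continuous_subspaceT; apply: mx_continuous => i j.
under [X in continuous X]eq_fun do rewrite mxE.
exact: coord_continuous.
Qed.

Lemma nearest_point_exists (R : realType) (p : nat) (C : set 'cV[R]_p)
    (u : 'cV[R]_p) :
  closed C -> C !=set0 ->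
  exists z, C z /\ forall y, C y -> enorm (u - z) <= enorm (u - y).
Proof.
move=> Ccl [c Cc].
(* The box contains every point at least as close to [u] as [c], so minimizing over the compact set
   [C] cut by [B] suffices: any other point of [C] is farther than [c]. *)
pose B := [set y : 'cV[R]_p | forall i, `|u i 0 - y i 0| <= enorm (u - c)].
have inB y : enorm (u - y) <= enorm (u - c) -> B y.
  by move=> le_yc i; apply: le_trans le_yc; have := coord_le_enorm (u - y) i;
     rewrite !mxE.
have [|||z /set_mem[Cz Bz] zmin] :=
    @compact_EVT_min _ R (fun y : 'cV[R]_p => enorm (u - y)) (C `&` B).
- by exists c; split => //; exact: inB.
- by rewrite setIC; apply: compact_closedI => //; exact: box_compact.
- by apply: continuous_subspaceT; exact: enorm_sub_continuous.
exists z; split => // y Cy.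
have [le_yc|lt_cy] := leP (enorm (u - y)) (enorm (u - c)).
  by apply: zmin; apply/mem_set; split => //; exact: inB.
by apply: le_trans (ltW lt_cy); apply: zmin; apply/mem_set; split => //; exact: inB.
Qed.

(** * The variational inequality of the projection onto a convex set *)

Lemma convex_set_in (R : realType) (p : nat) (C : set 'cV[R]_p) (x y : 'cV[R]_p)
    (t : R) :
  convex_set C -> C x -> C y -> 0 <= t -> t <= 1 -> C (x + t *: (y - x)).
Proof.
move=> cC Cx Cy t0 t1.
have := cC y x (Itv01 t0 t1) (mem_set Cy) (mem_set Cx) => /set_mem.
(* In the abstract convex combination [t] weights the first point, hence [y] was passed before
   [x]. *)
congr C; change (t *: y + (1 - t) *: x = x + t *: (y - x)).
by rewrite scalerBr scalerBl scale1r addrCA.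
Qed.

(** If the inner product [a] were positive, a short move from [z] towards [y] would stay in [C] and
    come strictly closer to [u]. *)
Lemma nearest_point_variational (R : realType) (p : nat) (C : set 'cV[R]_p)
    (u z : 'cV[R]_p) :
  convex_set C -> C z -> (forall y, C y -> enorm (u - z) <= enorm (u - y)) ->
  forall y, C y -> dot (u - z) (y - z) <= 0.
Proof.
move=> cC Cz zmin y Cy; rewrite leNgt; apply/negP.
set w := u - z; set d := y - z; pose a := dot w d; pose q := dot d d.
rewrite -/a => a_gt0.
have q_ge0 : 0 <= q := dot_ge0 _.
have qa_gt0 : 0 < q + a by rewrite ltr_wpDl.
(* This step length lies in (0, 1] even when [q] is 0, and [t * q = a - t * a < 2 * a] makes the
   squared distance decrease. *)
pose t := a / (q + a).
have t_gt0 : 0 < t by rewrite divr_gt0.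
have t_le1 : t <= 1 by rewrite ler_pdivrMr// mul1r lerDr.
have := zmin _ (convex_set_in cC Cz Cy (ltW t_gt0) t_le1).
rewrite ler_sqrt ?dot_ge0// opprD addrA -/d -/w dot_subZ -/a -/q.
apply/negP; rewrite -ltNge gtrBl mulr_gt0// subr_gt0.
have tqa : t * (q + a) = a by rewrite mulfVK// gt_eqF.
have ta_gt0 : 0 < t * a by rewrite mulr_gt0.
lra.
Qed.

(* Unqualified, [proj] would be the coordinate projection of MathComp-Analysis. *)
Lemma projP (R : realType) (p : nat) (C : set 'cV[R]_p) (u : 'cV[R]_p) :
  closed C -> convex_set C -> C !=set0 ->
  C (Defs.proj C u) /\ forall y, C y -> dot (u - Defs.proj C u) (y - Defs.proj C u) <= 0.
Proof.
move=> Ccl cC C0; have [Cz zmin] := xgetPex 0 (nearest_point_exists u Ccl C0).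
by split=> //; exact: nearest_point_variational.
Qed.

(** * Closedness and convexity of the two sets projected onto *)

Lemma orthant_closed (R : realType) (p : nat) : closed (@orthant R p).
Proof.
have -> : @orthant R p = \bigcap_(k in setT) [set z : 'cV[R]_p | 0 <= z k 0].
  by apply/seteqP; split => z zp; [move=> k _; exact: zp|move=> k; exact: zp].
apply: closed_bigI => k _.
apply: (@preimage_closed _ _ (fun z : 'cV[R]_p => z k 0) [set x : R | 0 <= x]).
  by move=> z _; exact: coord_continuous.
exact: closed_ge.
Qed.

Lemma orthant_convex (R : realType) (p : nat) : convex_set (@orthant R p).
Proof.
move=> x y t /set_mem xp /set_mem yp; apply/mem_set => k.
rewrite /conv/= !mxE; apply: addr_ge0; apply: mulr_ge0; first exact: ge0.
- exact: xp.
- by rewrite subr_ge0; exact: le1.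
- exact: yp.
Qed.

Lemma submxcol_continuous (R : realType) (N : nat) (n_ : 'I_N -> nat) (i : 'I_N) :
  continuous (fun x : 'cV[R]_(\sum_i n_ i) => submxcol x i).
Proof.
apply: mx_continuous => r j x.
have -> : (fun x : 'cV[R]_(\sum_i n_ i) => submxcol x i r j) =
          fun x => x (tagnat.Rank i r) j by apply/funext => y; rewrite mxE.
exact: coord_continuous.
Qed.

Lemma blockprod_closed (R : realType) (N : nat) (n_ : 'I_N -> nat)
    (Omega : forall i, set 'cV[R]_(n_ i)) :
  (forall i, closed (Omega i)) -> closed (blockprod Omega).
Proof.
move=> Ocl; have -> : blockprod Omega =
    \bigcap_(i in setT) (fun x => submxcol x i) @^-1` Omega i.
  by apply/seteqP; split => x Ox; [move=> i _; exact: Ox|move=> i; exact: Ox].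
apply: closed_bigI => i _; apply: preimage_closed => // x _.
exact: submxcol_continuous.
Qed.

Lemma blockprod_convex (R : realType) (N : nat) (n_ : 'I_N -> nat)
    (Omega : forall i, set 'cV[R]_(n_ i)) :
  (forall i, convex_set (Omega i)) -> convex_set (blockprod Omega).
Proof.
move=> Ocv x y t /set_mem Ox /set_mem Oy; apply/mem_set => i.
have := Ocv i _ _ t (mem_set (Ox i)) (mem_set (Oy i)) => /set_mem.
by congr (Omega i); apply/matrixP => k j; rewrite /conv/= !mxE.
Qed.

(** * The partial-consensus matrix and its quadratic form *)

Definition selector (R : realType) (n p : nat) (hn : (n <= p)%N) : 'M[R]_(n, p) :=
  rowsub (widen_ord hn) 1%:M.

Lemma selectorE (R : realType) (n p : nat) (hn : (n <= p)%N) (x : 'cV[R]_p) :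
  selector R hn *m x = firstn_mx hn x.
Proof. by rewrite /selector mul_rowsub_mx mul1mx. Qed.

(* The (a, b) block of K_n is L a b *: (E_a^T *m E_b), where E_a selects the
   first n components of block a. *)
Lemma pc_matrix_mul (R : realType) (N : nat) (n_ : 'I_N -> nat) (n : nat)
    (hn : forall i, (n <= n_ i)%N) (L : 'M[R]_N) (x : 'cV[R]_(\sum_i n_ i)) :
  pc_matrix n_ n L *m x = \mxcol_a
    \sum_b L a b *: ((selector R (hn a))^T *m firstn_mx (hn b) (submxcol x b)).
Proof.
rewrite -{1}(submxcolK x) /pc_matrix mul_mxblock_mxrow.
apply: eq_mxcol => a; apply: eq_bigr => b _.
rewrite -selectorE mulmxA scalemxAl; congr (_ *m _).
apply/matrixP => r s; rewrite !mxE.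
under eq_bigr do rewrite !mxE -!val_eqE /=.
have [rn|nr] := ltnP r n; last first.
  rewrite andbF big1 ?mulr0// => k _.
  by rewrite (ltn_eqF (leq_trans (ltn_ord k) nr)) mul0r.
rewrite andbT (bigD1 (Ordinal rn))//= eqxx mul1r big1 ?addr0.
  by case: eqP; rewrite ?mulr1 ?mulr0.
by move=> k /eqP kr; case: eqP => [krE|]; rewrite ?mul0r//; case: kr; exact/val_inj.
Qed.

(** The transposed selector of each block moves to the other side of the inner product, leaving the
    form of [L] on the first [n] components. *)
Lemma dot_pc_matrix (R : realType) (N : nat) (n_ : 'I_N -> nat) (n : nat)
    (hn : forall i, (n <= n_ i)%N) (L : 'M[R]_N) (x y : 'cV[R]_(\sum_i n_ i)) :
  dot x (pc_matrix n_ n L *m y) = \sum_a \sum_b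
    L a b * dot (firstn_mx (hn a) (submxcol x a)) (firstn_mx (hn b) (submxcol y b)).
Proof.
rewrite dot_blocks (pc_matrix_mul hn); apply: eq_bigr => a _.
rewrite mxcolK dot_sumr; apply: eq_bigr => b _; rewrite dotZr; congr (_ * _).
by rewrite /dot mulmxA -trmx_mul selectorE.
Qed.

Lemma laplacian_col_sum (R : realType) (N : nat) (W : 'M[R]_N) b :
  (forall a b, W a b = W b a) -> \sum_a laplacian W a b = 0.
Proof.
move=> Wsym; rewrite /laplacian.
under eq_bigr do rewrite !mxE.
rewrite big_split/= sumrN [X in X - _](bigD1 b)//= eqxx mulr1n.
rewrite [X in _ + X - _]big1 ?addr0; last by move=> a /negbTE ->.
(* Symmetry turns the degree of [b], a row sum, into the column sum it must cancel. *)
by rewrite [X in X - _](eq_bigr (W^~ b)) ?subrr// => a _; exact: Wsym.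
Qed.

Lemma laplacian_form (R : realType) (N n : nat) (W : 'M[R]_N)
    (X : 'I_N -> 'cV[R]_n) : (forall a b, W a b = W b a) ->
  (\sum_a \sum_b laplacian W a b * dot (X a) (X b)) *+ 2 =
  \sum_a \sum_b W a b * dot (X a - X b) (X a - X b).
Proof.
move=> Wsym.
have -> : \sum_a \sum_b laplacian W a b * dot (X a) (X b) =
  \sum_a \sum_b (W a b * dot (X a) (X a) - W a b * dot (X a) (X b)).
  apply: eq_bigr => a _; under eq_bigr do rewrite !mxE mulrBl.
  rewrite !big_split/=; congr (_ + _).
  rewrite (bigD1 a)//= eqxx mulr1n mulr_suml [X in _ + X]big1 ?addr0// => b.
  by rewrite eq_sym => /negbTE ->; rewrite mul0r.
(* Adding the copy with [a] and [b] exchanged completes the square; this is the source of the factor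
   2. *)
rewrite mulr2n {2}exchange_big/= -big_split; apply: eq_bigr => a _.
rewrite -big_split; apply: eq_bigr => b _ /=.
rewrite dotDl !dotDr !dotNl !dotNr (dotC (X b) (X a)) (Wsym b a); ring.
Qed.

Lemma pc_laplacian_ge0 (R : realType) (N : nat) (n_ : 'I_N -> nat) (n : nat)
    (hn : forall i, (n <= n_ i)%N) (W : 'M[R]_N) (x : 'cV[R]_(\sum_i n_ i)) :
  connected_weights W -> 0 <= dot x (pc_matrix n_ n (laplacian W) *m x).
Proof.
move=> [Wsym W_ge0 _]; rewrite (dot_pc_matrix hn) -(pmulrn_lge0 _ (ltn0Sn 1)).
rewrite (laplacian_form (fun a => firstn_mx (hn a) (submxcol x a)) Wsym).
by do 2![apply: sumr_ge0 => ? _]; rewrite mulr_ge0 ?dot_ge0.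
Qed.

(** A zero sum of nonnegative terms has only zero terms, so the parts agree across each edge of
    positive weight, hence along a path from [a] to [b]. *)
Lemma pc_laplacian_kernel (R : realType) (N : nat) (n_ : 'I_N -> nat) (n : nat)
    (hn : forall i, (n <= n_ i)%N) (W : 'M[R]_N) (x : 'cV[R]_(\sum_i n_ i)) a b :
  connected_weights W -> pc_matrix n_ n (laplacian W) *m x = 0 ->
  firstn_mx (hn a) (submxcol x a) = firstn_mx (hn b) (submxcol x b).
Proof.
move=> [Wsym W_ge0 Wcon] Kx0; pose X a := firstn_mx (hn a) (submxcol x a).
have : \sum_a \sum_b W a b * dot (X a - X b) (X a - X b) = 0.
  by rewrite -laplacian_form// -dot_pc_matrix Kx0 /dot mulmx0 mxE mul0rn.
have term_ge0 c d : 0 <= W c d * dot (X c - X d) (X c - X d).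
  by rewrite mulr_ge0 ?dot_ge0.
move=> /psumr_eq0P sum0.
have edge c d : 0 < W c d -> X c = X d.
  move=> Wcd; have /psumr_eq0P /(_ d isT) : _ = 0 :=
    sum0 (fun c _ => sumr_ge0 _ (fun d _ => term_ge0 c d)) c isT.
  move=> /(_ (fun d _ => term_ge0 c d)) /eqP.
  by rewrite mulf_eq0 gt_eqF//= => /eqP/dot_eq0/subr0_eq.
have /connectP[p + ->] := Wcon a b; rewrite -/(X a) -/(X _).
by elim: p a => //= c p IHp a /andP[/edge -> /IHp].
Qed.

(** For a consensus [x] the sum over [a] factors through a column sum of the Laplacian. *)
Lemma dot_consensus_pc_laplacian (R : realType) (N : nat) (n_ : 'I_N -> nat)
    (n : nat) (hn : forall i, (n <= n_ i)%N) (W : 'M[R]_N)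
    (x y : 'cV[R]_(\sum_i n_ i)) :
  connected_weights W ->
  (forall a b, firstn_mx (hn a) (submxcol x a) = firstn_mx (hn b) (submxcol x b)) ->
  dot x (pc_matrix n_ n (laplacian W) *m y) = 0.
Proof.
move=> [Wsym _ _] xcons; rewrite (dot_pc_matrix hn) exchange_big big1//= => b _.
under eq_bigr do rewrite (xcons _ b).
by rewrite -mulr_suml laplacian_col_sum// mul0r.
Qed.

(** * Sign of the largest eigenvalue, complementarity, and optimality *)

Lemma largest_eigenvalue_ge0 (R : realType) (p : nat) (A : 'M[R]_p) :
  (forall x, 0 <= dot x (A *m x)) -> 0 <= largest_eigenvalue A.
Proof.
move=> A_ge0; rewrite /largest_eigenvalue.
(* Eigenvectors are row vectors here, hence the transposes; the default value 0 of [xget] satisfies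
   the goal at once. *)
case: xgetP => [d _ [/eigenvalueP[v vA v0] _]|_]//.
have : 0 <= d * dot v^T v^T.
  by have := A_ge0 v^T; rewrite /dot trmxK mulmxA vA -scalemxAl mxE.
rewrite pmulr_lge0// lt_neqAle dot_ge0 andbT eq_sym.
by apply: contraNN v0 => /eqP/dot_eq0 vT0; rewrite -(trmxK v) vT0 trmx0.
Qed.

Lemma complementarity (R : realType) (p : nat) (mu h : 'cV[R]_p) :
  mu = Defs.proj (@orthant R p) (mu + h) ->
  [/\ forall k, 0 <= mu k 0, forall k, h k 0 <= 0 & 0 <= dot mu h].
Proof.
move=> muE; have [|] := projP (mu + h) (@orthant_closed R p) (@orthant_convex R p).
  by exists 0 => k; rewrite mxE.
rewrite -muE addrAC subrr add0r => mu_ge0 hvar; split => // [k|].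
  (* Testing with [mu] plus a unit vector isolates [h k 0]; testing with 0 below gives the sign of
     [dot mu h]. *)
  have := hvar (mu + delta_mx k 0); rewrite addrAC subrr add0r dotE (bigD1 k)//=.
  rewrite big1 ?addr0; last first.
    by move=> j jk; rewrite mxE (negbTE jk) mulr0.
  rewrite mxE !eqxx mulr1; apply => j.
  by rewrite !mxE addr_ge0// ler0n.
have := hvar 0; rewrite sub0r dotNr oppr_le0 dotC; apply.
by move=> k; rewrite mxE.
Qed.

Theorem theorem1 (R : realType) (N : nat) (n_ m_ : 'I_N -> nat) (n : nat)
  (hN : (1 <= N)%N)
  (hn_ : forall i, (1 <= n_ i)%N)
  (hm_ : forall i, (1 <= m_ i)%N)
  (hn1 : (1 <= n)%N)
  (hn : forall i, (n <= n_ i)%N)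
  (W : 'M[R]_N)
  (hW : connected_weights W)
  (Omega : forall i, set 'cV[R]_(n_ i))
  (f : forall i, 'cV[R]_(n_ i) -> R)
  (g : forall i, 'cV[R]_(n_ i) -> 'cV[R]_(m_ i))
  (hOclosed : forall i, closed (Omega i))
  (hOconvex : forall i, convex_set (Omega i))
  (hfconvex : forall i, convex_function setT (f i))
  (hfcont : forall i, continuous (f i))
  (hgconvex : forall i k, convex_function setT (fun z => g i z k 0))
  (hgcont : forall i, continuous (g i))
  (hslater : exists xbar : 'cV[R]_(\sum_i n_ i),
     (blockprod Omega)° xbar /\
     forall i k, g i (submxcol xbar i) k 0 < 0)
  (xhat lambdahat : 'cV[R]_(\sum_i n_ i))
  (muhat : 'cV[R]_(\sum_i m_ i)) :
  let K := pc_matrix n_ n (laplacian W) in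
  let delta := largest_eigenvalue K + 1 in
  equilibrium Omega f g K delta xhat lambdahat muhat ->
  global_minimizer (objective f) (feasible hn Omega g) xhat.
Proof.
move=> K delta [[v vF [w wG x_eq]] Kx0 mu_eq].
(* Positivity of the form bounds the largest eigenvalue below by 0; [delta] and [2 * delta] can then
   be cancelled from the equilibrium relations. *)
have delta_gt0 : 0 < delta.
  rewrite ltr_wpDl// largest_eigenvalue_ge0// => x; exact: pc_laplacian_ge0.
have PmuE : Pplus g xhat muhat = muhat.
  apply/subr0_eq/eqP; move/eqP: mu_eq.
  by rewrite /rhs_mu scaler_eq0 gt_eqF.
rewrite PmuE in wG; rewrite /rhs_lambda in Kx0.
have comp i : [/\ forall k, 0 <= submxcol muhat i k 0,
    forall k, g i (submxcol xhat i) k 0 <= 0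
    & 0 <= dot (submxcol muhat i) (g i (submxcol xhat i))].
  by apply: complementarity; rewrite -{1}PmuE /Pplus mxcolK.
have [|] := projP (xhat - v - w - K *m lambdahat - K *m xhat)
    (blockprod_closed hOclosed) (blockprod_convex hOconvex).
  by have [xbar [/interior_subset Oxbar _]] := hslater; exists xbar.
have -> : Defs.proj (blockprod Omega) (xhat - v - w - K *m lambdahat - K *m xhat) = xhat.
  apply/subr0_eq/eqP; move/eqP: x_eq.
  by rewrite -scalerBr scaler_eq0 mulf_eq0 pnatr_eq0/= gt_eqF.
rewrite Kx0 subr0 => Oxhat var.
have xcons a b := pc_laplacian_kernel hn a b hW Kx0.
split; first by split => // i k; have [_ + _] := comp i; apply.
move=> y [ycons gy Oy].
have lam0 : dot (K *m lambdahat) (y - xhat) = 0.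
  rewrite dotC; apply: (dot_consensus_pc_laplacian _ hW (hn := hn)) => a b.
  by rewrite !submxcolB -!selectorE !mulmxBr !selectorE (ycons a b) (xcons a b).
have w_le0 : dot w (y - xhat) <= 0.
  have [xi [xiP ->]] := wG; rewrite dot_blocks; apply: sumr_le0 => i _.
  have [mu_ge0 _ mug] := comp i.
  rewrite mxcolK submxcolB dot_suml.
  have mugy : \sum_k submxcol muhat i k 0 * g i (submxcol y i) k 0 <= 0.
    by apply: sumr_le0 => k _; rewrite mulr_ge0_le0.
  rewrite dotE in mug.
  (* The subgradient inequalities are weighted by the nonnegative multipliers; then [mugy] and [mug]
     bound the two halves of the difference. *)
  apply: (@le_trans _ _ (\sum_k submxcol muhat i k 0 *
      (g i (submxcol y i) k 0 - g i (submxcol xhat i) k 0))).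
    apply: ler_sum => k _; rewrite dotZl ler_wpM2l// lerBrDl.
    exact: xiP.
  by under eq_bigr do rewrite mulrBr; rewrite sumrB; lra.
have := var y Oy.
have -> : xhat - v - w - K *m lambdahat - xhat = - v - w - K *m lambdahat.
  by rewrite [LHS]addrC !addrA addNr add0r.
rewrite !dotDl !dotNl lam0 => var_y.
(* [var_y] and [w_le0] give [0 <= dot v (y - xhat)], which the subgradient inequality of the
   objective turns into the claim. *)
by have := vF y; lra.
Qed.
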